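(* Let $n \ge 931$ be an integer and $m$ an integer with $0\le m \le n/8$. Let $p(m,n)=\frac12+\frac{m}{2n}+\sqrt{\frac{1}{2n}\ln 6}$. Let $\mathbf{W}$ be distributed as $m+\mathrm{Bin}(n-m,\frac12)$ and $\mathbf{W}^+$ be distributed as $\mathrm{Bin}(n,p(m,n))$. Then for every set $\mathcal{W}\subseteq\{0,1,\dots,n\}$, \[ \Pr[\mathbf{W}^+\in\mathcal W]\le 51\cdot \Pr[\mathbf{W}\in\mathcal W]+\frac13 . \]
   Context: $\mathrm{Bin}(N,q)$ denotes the binomial distribution with $N$ trials and success probability $q$; $m+\mathrm{Bin}(n-m,\frac12)$ denotes the distribution of $m$ plus a $\mathrm{Bin}(n-m,\frac12)$ random variable. *)

(* Defs.v *)
From Stdlib Require Export Reals Arith.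
Open Scope R_scope.

Definition binom_pmf (N : nat) (q : R) (k : nat) : R :=
  if (k <=? N)%nat then Binomial.C N k * q ^ k * (1 - q) ^ (N - k) else 0.

Definition shifted_pmf (n m : nat) (k : nat) : R :=
  if (m <=? k)%nat then binom_pmf (n - m) (1/2) (k - m) else 0.

Definition prob_in (n : nat) (f : nat -> R) (S : nat -> bool) : R :=
  sum_f_R0 (fun k => if S k then f k else 0) n.

Definition p_mn (m n : nat) : R :=
  1/2 + INR m / (2 * INR n) + sqrt (/ (2 * INR n) * ln 6).

(* Main.v *)
Require Import Defs.
From Stdlib Require Import Reals Arith Lra Lia.
From Coquelicot Require Import Coquelicot.
Open Scope R_scope.

(** Write [P] and [Q] for the laws of W+ and W, and [v] for the deviation of [k] from the mean of
    [P] in units of [sqrt n / 2].  It suffices that [P k <= 51 * Q k + P k * h k] for every [k]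
    with [h k = (7/20 + 9/20 v)^2], because the [P]-mean of [h] is at most
    [(7/20)^2 + (9/20)^2 < 1/3].  This is trivial when [h k >= 1], so [v] is bounded.  There
    [P k] and [Q k] are factored as the value at [k] of the binomial law whose mean is [k], times
    an exponential of a Bernoulli relative entropy.  The first factors compare because
    [(1 + 1/k)^k] increases.  Pinsker's inequality and a second-order upper bound on the entropy
    reduce the exponential factors to Gaussians, and what remains is an inequality in [v] alone. *)

(** * Binomial weights and their second moment *)

Lemma binom_pmf_nonneg (N : nat) (q : R) (k : nat) :
  0 <= q <= 1 -> 0 <= binom_pmf N q k.
Proof.
  intros Hq. unfold binom_pmf. destruct (k <=? N)%nat; [|lra].
  apply Rmult_le_pos; [apply Rmult_le_pos|]; try (apply pow_le; lra).
  unfold Binomial.C. apply Rlt_le, Rdiv_lt_0_compat; [apply INR_fact_lt_0|].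
  apply Rmult_lt_0_compat; apply INR_fact_lt_0.
Qed.

Lemma shifted_pmf_nonneg (n m k : nat) : 0 <= shifted_pmf n m k.
Proof.
  unfold shifted_pmf. destruct (m <=? k)%nat; [|lra].
  apply binom_pmf_nonneg; lra.
Qed.

Lemma C_n_0 (n : nat) : Binomial.C n 0 = 1.
Proof.
  unfold Binomial.C. rewrite Nat.sub_0_r. simpl. field. apply INR_fact_neq_0.
Qed.

Lemma C_n_n (n : nat) : Binomial.C n n = 1.
Proof.
  unfold Binomial.C. rewrite Nat.sub_diag. simpl. field. apply INR_fact_neq_0.
Qed.

Lemma binom_pmf_S_0 (n : nat) (q : R) :
  binom_pmf (S n) q 0 = (1 - q) * binom_pmf n q 0.
Proof.
  unfold binom_pmf. simpl Nat.leb. cbv iota.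
  rewrite !C_n_0, !Nat.sub_0_r. simpl. ring.
Qed.

Lemma binom_pmf_S_S (n : nat) (q : R) (k : nat) :
  binom_pmf (S n) q (S k) = q * binom_pmf n q k + (1 - q) * binom_pmf n q (S k).
Proof.
  unfold binom_pmf.
  destruct (Nat.leb_spec (S k) (S n)); destruct (Nat.leb_spec k n);
    destruct (Nat.leb_spec (S k) n); try lia; try ring.
  - rewrite <- (pascal n k) by lia.
    replace (S n - S k)%nat with (S (n - S k)) by lia.
    replace (n - k)%nat with (S (n - S k)) by lia.
    simpl. ring.
  - replace k with n by lia. rewrite !C_n_n, !Nat.sub_diag. simpl. ring.
Qed.

Lemma binom_pmf_gt (n : nat) (q : R) (k : nat) : (n < k)%nat -> binom_pmf n q k = 0.
Proof.
  intros H. unfold binom_pmf. destruct (Nat.leb_spec k n); [lia|reflexivity].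
Qed.

(** Conditioning on one trial. Keeping [g] arbitrary lets moments follow by induction on [n]. *)
Lemma binom_sum_S (n : nat) (q : R) (g : nat -> R) :
  sum_f_R0 (fun k => binom_pmf (S n) q k * g k) (S n) =
  q * sum_f_R0 (fun k => binom_pmf n q k * g (S k)) n +
  (1 - q) * sum_f_R0 (fun k => binom_pmf n q k * g k) n.
Proof.
  rewrite decomp_sum by lia. simpl pred.
  rewrite (sum_eq _ (fun k => binom_pmf n q k * g (S k) * q +
                              binom_pmf n q (S k) * g (S k) * (1 - q)))
    by (intros; rewrite binom_pmf_S_S; ring).
  rewrite sum_plus.
  rewrite <- !scal_sum, binom_pmf_S_0.
  (* The failure sum is extended by a zero term at [S n], so that its term at index 0 can be split
     off. *)
  assert (H : sum_f_R0 (fun k => binom_pmf n q k * g k) (S n) =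
              sum_f_R0 (fun k => binom_pmf n q k * g k) n).
  { rewrite tech5, binom_pmf_gt by lia. ring. }
  rewrite <- H, (decomp_sum _ (S n)) by lia. simpl pred. ring.
Qed.

Lemma binom_second_moment (n : nat) (q : R) : forall a b,
  sum_f_R0 (fun k => binom_pmf n q k * (a + b * INR k) ^ 2) n =
  (a + b * (INR n * q)) ^ 2 + b ^ 2 * (INR n * q * (1 - q)).
Proof.
  (* [a] and [b] stay general because a success replaces [a] by [a + b]. *)
  induction n as [|n IH]; intros a b.
  - unfold binom_pmf. simpl. rewrite C_n_0. ring.
  - rewrite binom_sum_S.
    rewrite (sum_eq _ (fun k => binom_pmf n q k * ((a + b) + b * INR k) ^ 2))
      by (intros; rewrite S_INR; f_equal; ring).
    rewrite !IH, S_INR. ring.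
Qed.

(** * Monotonicity of the binomial peak *)

Lemma Bernoulli_inequality (x : R) (n : nat) : -1 <= x -> 1 + INR n * x <= (1 + x) ^ n.
Proof.
  intros Hx. induction n as [|n IH]; [simpl; lra|].
  rewrite S_INR. simpl.
  assert (0 <= INR n) by apply pos_INR.
  apply Rle_trans with ((1 + x) * (1 + INR n * x)); [nra|].
  apply Rmult_le_compat_l; lra.
Qed.

(** The quotient of the two bases is [1 - 1/(k+1)^2]. By Bernoulli its power [k+1] is at least
    [k/(k+1)], which cancels the extra factor [(k+1)/k]. *)
Lemma compound_growth_S (k : nat) : (0 < k)%nat ->
  ((INR k + 1) / INR k) ^ k <= ((INR k + 2) / (INR k + 1)) ^ (S k).
Proof.
  intros Hk. apply lt_INR in Hk. simpl in Hk. set (x := INR k) in *.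
  replace ((x + 2) / (x + 1))
    with ((x + 1) / x * (1 + - / ((x + 1) * (x + 1)))) by (field; lra).
  rewrite Rpow_mult_distr.
  assert (H := Bernoulli_inequality (- / ((x + 1) * (x + 1))) (S k)).
  rewrite S_INR in H. fold x in H.
  assert (H1 : -1 <= - / ((x + 1) * (x + 1))).
  { assert (/ ((x + 1) * (x + 1)) <= / 1) by (apply Rinv_le_contravar; nra).
    rewrite Rinv_1 in *. lra. }
  specialize (H H1).
  replace (1 + (x + 1) * - / ((x + 1) * (x + 1))) with (x / (x + 1)) in H by (field; lra).
  apply Rle_trans with (((x + 1) / x) ^ S k * (x / (x + 1))).
  - simpl. right. field. lra.
  - apply Rmult_le_compat_l; [|exact H]. apply pow_le, Rlt_le, Rdiv_lt_0_compat; lra.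
Qed.

Lemma compound_growth_le (k n : nat) : (0 < k)%nat -> (k <= n)%nat ->
  ((INR k + 1) / INR k) ^ k <= ((INR n + 1) / INR n) ^ n.
Proof.
  intros Hk Hn. induction Hn as [|n Hn IH]; [lra|].
  eapply Rle_trans; [exact IH|].
  eapply Rle_trans; [apply compound_growth_S; lia|].
  rewrite S_INR. right. f_equal. f_equal. ring.
Qed.

(* The value at [k] of the binomial law whose mean is [k]. *)
Definition binom_peak (n k : nat) : R :=
  Binomial.C n k * INR k ^ k * INR (n - k) ^ (n - k) / INR n ^ n.

Lemma binom_peak_pos (n k : nat) : (0 < k < n)%nat -> 0 < binom_peak n k.
Proof.
  intros H. unfold binom_peak, Binomial.C.
  repeat (apply Rmult_lt_0_compat || apply Rdiv_lt_0_compat || apply pow_lt ||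
          apply INR_fact_lt_0 || apply Rinv_0_lt_compat);
  apply lt_0_INR; lia.
Qed.

Lemma C_S_S (n k : nat) : (k <= n)%nat ->
  Binomial.C (S n) (S k) = Binomial.C n k * (INR n + 1) / (INR k + 1).
Proof.
  intros H. unfold Binomial.C. simpl Nat.sub.
  rewrite !fact_simpl, !mult_INR, !S_INR. field.
  repeat split; try apply INR_fact_neq_0. pose proof (pos_INR k). lra.
Qed.

(** The quotient of the two peaks is exactly [(1+1/k)^k / (1+1/n)^n]. *)
Lemma binom_peak_S_S (n k : nat) : (0 < k < n)%nat ->
  binom_peak (S n) (S k) <= binom_peak n k.
Proof.
  intros [Hk Hn].
  assert (H := compound_growth_le k n Hk (Nat.lt_le_incl _ _ Hn)).
  assert (Pk : 0 < INR k) by (apply lt_0_INR; lia).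
  assert (Pn : 0 < INR n) by (apply lt_0_INR; lia).
  assert (Pp := binom_peak_pos n k (conj Hk Hn)).
  replace (binom_peak (S n) (S k)) with
    (binom_peak n k * (((INR k + 1) / INR k) ^ k / ((INR n + 1) / INR n) ^ n)).
  - rewrite <- (Rmult_1_r (binom_peak n k)) at 2.
    apply Rmult_le_compat_l; [lra|].
    apply Rle_div_l; [apply pow_lt, Rdiv_lt_0_compat; lra|lra].
  - unfold binom_peak. rewrite C_S_S by lia. simpl Nat.sub.
    rewrite !S_INR. unfold Rdiv. rewrite !Rpow_mult_distr, !pow_inv. simpl pow.
    field. repeat split; try apply pow_nonzero; lra.
Qed.

Lemma binom_peak_shift (m n k : nat) : (0 < k < n)%nat ->
  binom_peak (n + m) (k + m) <= binom_peak n k.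
Proof.
  intros H. induction m as [|m IH].
  - rewrite !Nat.add_0_r. lra.
  - rewrite !Nat.add_succ_r. eapply Rle_trans; [apply binom_peak_S_S; lia|exact IH].
Qed.

(** * Bernoulli relative entropy *)

Definition bernoulli_kl (x q : R) : R :=
  x * (ln x - ln q) + (1 - x) * (ln (1 - x) - ln (1 - q)).

Lemma pow_exp_ln (x : R) (k : nat) : 0 < x -> x ^ k = exp (INR k * ln x).
Proof. intros H. rewrite <- Rpower_pow by exact H. reflexivity. Qed.

(** All dependence on [q] goes into the exponent. The binomial coefficient stays inside the peak, so
    no Stirling estimate enters. *)
Lemma binom_pmf_peak (n k : nat) (q : R) : (0 < k < n)%nat -> 0 < q < 1 ->
  binom_pmf n q k = binom_peak n k * exp (- (INR n * bernoulli_kl (INR k / INR n) q)).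
Proof.
  intros [Hk Hn] Hq.
  assert (Pk : 0 < INR k) by (apply lt_0_INR; lia).
  assert (Pn : 0 < INR n) by (apply lt_0_INR; lia).
  assert (Pj : 0 < INR (n - k)) by (apply lt_0_INR; lia).
  unfold binom_pmf, binom_peak, bernoulli_kl.
  destruct (Nat.leb_spec k n); [|lia].
  replace (1 - INR k / INR n) with (INR (n - k) / INR n)
    by (rewrite minus_INR by lia; field; lra).
  rewrite !ln_div by lra. rewrite !pow_exp_ln by lra.
  replace (INR n * (INR k / INR n * (ln (INR k) - ln (INR n) - ln q) +
     INR (n - k) / INR n * (ln (INR (n - k)) - ln (INR n) - ln (1 - q))))
    with (INR k * (ln (INR k) - ln (INR n) - ln q) +
     INR (n - k) * (ln (INR (n - k)) - ln (INR n) - ln (1 - q))) by (field; lra).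
  unfold Rdiv. rewrite <- exp_Ropp, !Rmult_assoc, <- !exp_plus.
  f_equal. f_equal. rewrite minus_INR by lia. ring.
Qed.

(** The entropy has derivative [(y-x)/(y(1-y))] in its second argument and vanishes at [y = x]. The
    mean value theorem then reduces comparison with [2c(q-x)^2] to comparing [1/(y(1-y))] with [4c],
    which serves for lower and upper bounds alike. *)
Lemma bernoulli_kl_mvt (c x q : R) : 0 < x < 1 -> 0 < q < 1 ->
  exists y, Rmin x q <= y <= Rmax x q /\
    bernoulli_kl x q - 2 * c * (q - x) ^ 2 =
    (y - x) * (q - x) * (/ (y * (1 - y)) - 4 * c).
Proof.
  intros Hx Hq.
  assert (Hy : forall y, Rmin x q <= y <= Rmax x q -> 0 < y < 1).
  { intros y. unfold Rmin, Rmax. destruct (Rle_dec x q); lra. }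
  destruct (MVT_gen (fun y => - x * ln y - (1 - x) * ln (1 - y) - 2 * c * (y - x) ^ 2)
    x q (fun y => (y - x) * (/ (y * (1 - y)) - 4 * c))) as (y & Hin & E).
  - intros y H. assert (0 < y < 1) by (apply Hy; lra).
    auto_derive; [lra|field; lra].
  - intros y H. assert (0 < y < 1) by (apply Hy; lra).
    apply continuity_pt_filterlim.
    apply (ex_derive_continuous
      (fun y => - x * ln y - (1 - x) * ln (1 - y) - 2 * c * (y - x) ^ 2)).
    auto_derive; lra.
  - exists y. split; [exact Hin|].
    unfold bernoulli_kl. nra.
Qed.

Lemma between_mul_nonneg (x q y : R) :
  Rmin x q <= y <= Rmax x q -> 0 <= (y - x) * (q - x).
Proof. unfold Rmin, Rmax. destruct (Rle_dec x q); intros; nra. Qed.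

Lemma bernoulli_pinsker (x q : R) : 0 < x < 1 -> 0 < q < 1 ->
  2 * (q - x) ^ 2 <= bernoulli_kl x q.
Proof.
  intros Hx Hq. destruct (bernoulli_kl_mvt 1 x q Hx Hq) as (y & Hy & E).
  assert (H1 := between_mul_nonneg x q y Hy).
  assert (H : 0 < y < 1) by (revert Hy; unfold Rmin, Rmax; destruct (Rle_dec x q); lra).
  assert (4 <= / (y * (1 - y))).
  { replace 4 with (/ (1 / 4)) by field.
    pose proof (pow2_ge_0 (y - 1 / 2)). apply Rinv_le_contravar; nra. }
  nra.
Qed.

Lemma bernoulli_kl_half_le (x : R) : 0 < x < 1 -> (2 * x - 1) ^ 2 <= 1 / 21 ->
  bernoulli_kl x (1 / 2) <= 21 / 40 * (2 * x - 1) ^ 2.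
Proof.
  intros Hx Hs.
  destruct (bernoulli_kl_mvt (21 / 20) x (1 / 2) Hx ltac:(lra)) as (y & Hy & E).
  assert (H1 := between_mul_nonneg x (1 / 2) y Hy).
  assert (H : 5 / 21 <= y * (1 - y)).
  (* [y(1-y) = (1-(2y-1)^2)/4], and [(1-1/21)/4 = 5/21], the reciprocal of [4c] for [c = 21/20]. *)
  { revert Hy; unfold Rmin, Rmax; destruct (Rle_dec x (1 / 2)); intros; nra. }
  assert (/ (y * (1 - y)) <= 21 / 5).
  { replace (21 / 5) with (/ (5 / 21)) by field. apply Rinv_le_contravar; lra. }
  nra.
Qed.

(** * Numerical bounds and the Gaussian comparison *)

Lemma exp_le (x y : R) : x <= y -> exp x <= exp y.
Proof. intros [H| ->]; [left; apply exp_increasing; exact H|right; reflexivity]. Qed.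

Lemma exp_double_ge (x y : R) : 0 <= x -> x <= exp y -> x * x <= exp (2 * y).
Proof.
  intros Hx H. replace (2 * y) with (y + y) by ring. rewrite exp_plus. nra.
Qed.

Lemma ln_6_le : ln 6 <= 9 / 5.
Proof.
  assert (H : 6 <= exp (9 / 5)).
  { eapply Rle_trans; [|apply (exp_ge_taylor (9 / 5) 7); lra].
    simpl. lra. }
  rewrite <- (ln_exp (9 / 5)). apply ln_le; lra.
Qed.

Lemma ln_6_ge : 1 <= ln 6.
Proof.
  rewrite <- (ln_exp 1). apply ln_le; [apply exp_pos|]. pose proof exp_le_3. lra.
Qed.

Lemma exp_opp_24_5_ge : 81 / 10000 <= exp (- (24 / 5)).
Proof.
  (* Ten squarings lead from [-3/640] to [-24/5], as [1024 * 3/640 = 24/5]. Each [b] below is a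
     square rounded down. *)
  assert (H : 9953125 / 10000000 <= exp (- (3 / 640))).
  { eapply Rle_trans; [|apply exp_ineq1_le]. lra. }
  assert (D : forall a y b, a <= exp y -> 0 <= b -> 0 <= a -> b <= a * a -> b <= exp (2 * y)).
  { intros a y b H1 H2 H3 H4. apply Rle_trans with (a * a); [exact H4|].
    apply exp_double_ge; lra. }
  apply D with (b := 990646 / 1000000) in H; try lra.
  apply D with (b := 981379 / 1000000) in H; try lra.
  apply D with (b := 963104 / 1000000) in H; try lra.
  apply D with (b := 927569 / 1000000) in H; try lra.
  apply D with (b := 860384 / 1000000) in H; try lra.
  apply D with (b := 740260 / 1000000) in H; try lra.
  apply D with (b := 547984 / 1000000) in H; try lra.
  apply D with (b := 300286 / 1000000) in H; try lra.
  apply D with (b := 90171 / 1000000) in H; try lra.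
  apply D with (b := 8130 / 1000000) in H; try lra.
  replace (- (24 / 5)) with (2 * (2 * (2 * (2 * (2 * (2 * (2 * (2 * (2 * (2 * - (3 / 640)))))))))))
    by field.
  lra.
Qed.

(* With [d = sqrt (2 ln 6)], the two sides compare the Gaussian profiles of the two laws.
   The exponential is bounded below by its tangent at [- 24/5]. *)
Lemma gaussian_profile_compare (d v : R) : d * d = 2 * ln 6 -> 0 <= d ->
  -3 <= v <= 13 / 9 ->
  exp (- (v ^ 2 / 2)) * (1 - (7 / 20 + 9 / 20 * v) ^ 2) <=
  51 * exp (- (3 / 5 * (v + d) ^ 2)).
Proof.
  intros Hd d0 Hv.
  pose proof ln_6_le. pose proof ln_6_ge.
  assert (d1 : 1 <= d <= 19 / 10) by nra.
  (* [X] equals [3/5 (v+d)^2 - v^2/2] once [d^2] is replaced by [2 ln 6]. *)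
  set (X := v ^ 2 / 10 + 6 / 5 * d * v + 6 / 5 * ln 6).
  replace (exp (- (3 / 5 * (v + d) ^ 2))) with (exp (- (v ^ 2 / 2)) * exp (- X)).
  2: { rewrite <- exp_plus. f_equal. unfold X. nra. }
  assert (Pe := exp_pos (- (v ^ 2 / 2))).
  cut (1 - (7 / 20 + 9 / 20 * v) ^ 2 <= 51 * exp (- X)); [intros; nra|].
  replace (- X) with (- (24 / 5) + (24 / 5 - X)) by ring. rewrite exp_plus.
  pose proof exp_opp_24_5_ge as E1.
  pose proof (exp_ineq1_le (24 / 5 - X)) as E2.
  assert (E3 : 81 / 10000 * (29 / 5 - X) <= exp (- (24 / 5)) * exp (24 / 5 - X)).
  { pose proof (exp_pos (24 / 5 - X)). nra. }
  (* [216/100 = 6/5 * 9/5] bounds the constant term of [X]. For [v <= 0] the other terms sum to at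
     most 0; for [v > 0] they are bounded linearly, using [v <= 13/9] and [d <= 19/10]. *)
  destruct (Rle_dec v 0).
  - assert (X <= 216 / 100) by (unfold X; nra). nra.
  - assert (X <= 216 / 100 + (13 / 90 + 228 / 100) * v) by (unfold X; nra). nra.
Qed.

(** In this form the mean of W+ visibly exceeds that of W by [sqrt (2 ln 6)] units of
    [sqrt n / 2]. *)
Lemma p_mn_eq (m n : nat) : (0 < n)%nat ->
  p_mn m n = 1 / 2 + INR m / (2 * INR n) + sqrt (2 * ln 6) / (2 * sqrt (INR n)).
Proof.
  intros Hn. apply lt_0_INR in Hn. pose proof ln_6_ge.
  unfold p_mn. f_equal.
  apply sqrt_lem_1.
  - apply Rmult_le_pos; [apply Rlt_le, Rinv_0_lt_compat|]; lra.
  - apply Rdiv_le_0_compat; [apply sqrt_pos|]. pose proof (sqrt_lt_R0 _ Hn). lra.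
  - pose proof (sqrt_lt_R0 _ Hn).
    replace (sqrt (2 * ln 6) / (2 * sqrt (INR n)) * (sqrt (2 * ln 6) / (2 * sqrt (INR n))))
      with (sqrt (2 * ln 6) * sqrt (2 * ln 6) / (4 * (sqrt (INR n) * sqrt (INR n))))
      by (field; lra).
    rewrite !sqrt_sqrt by lra. field. lra.
Qed.

(** * Pointwise comparison of the two laws *)

Section Pointwise.

Variables n m : nat.
Hypothesis hn : (931 <= n)%nat.
Hypothesis hm : (8 * m <= n)%nat.

Let N := INR n.
Let M := INR m.
Let s := sqrt N.
Let d := sqrt (2 * ln 6).

(* The deviation from the mean of [Bin(n, p)], in units of [sqrt n / 2]. *)
Definition deviation (k : nat) : R := 2 * (INR k - INR n * p_mn m n) / sqrt (INR n).

(** The parabola is centred at [v = -7/9], left of the mean: the quotient of the Gaussian profiles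
    grows with [v], so the right tail has to be cut off sooner than the left. *)
Definition tail_weight (k : nat) : R := (7 / 20 + 9 / 20 * deviation k) ^ 2.

Let N_ge : 931 <= N.
Proof. apply le_INR in hn. rewrite INR_IZR_INZ in hn. exact hn. Qed.

Let M_le : 0 <= M /\ 8 * M <= N.
Proof.
  split; [apply pos_INR|]. apply le_INR in hm. rewrite mult_INR in hm.
  replace (INR 8) with 8 in hm by (simpl; ring). exact hm.
Qed.

Let s_sq : s * s = N.
Proof. apply sqrt_sqrt. lra. Qed.

Let s_ge : 30 <= s.
Proof. assert (0 <= s) by apply sqrt_pos. nra. Qed.

Let d_sq : d * d = 2 * ln 6.
Proof. apply sqrt_sqrt. pose proof ln_6_ge. lra. Qed.

Let d_bounds : 1 <= d <= 19 / 10.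
Proof.
  assert (0 <= d) by apply sqrt_pos. pose proof ln_6_ge. pose proof ln_6_le. nra.
Qed.

Let p_eq : p_mn m n = 1 / 2 + M / (2 * N) + d / (2 * s).
Proof. apply p_mn_eq. lia. Qed.

Lemma p_mn_bounds : 0 < p_mn m n < 1.
Proof.
  rewrite p_eq.
  assert (0 <= M / (2 * N)) by (apply Rdiv_le_0_compat; lra).
  assert (M / (2 * N) <= 1 / 16) by (apply Rle_div_l; lra).
  assert (0 < d / (2 * s)) by (apply Rdiv_lt_0_compat; lra).
  assert (d / (2 * s) <= 1 / 16) by (apply Rle_div_l; lra).
  lra.
Qed.

Let deviation_eq (k : nat) : 2 * INR k = N + M + s * (deviation k + d).
Proof.
  unfold deviation. rewrite p_eq. fold N s. rewrite <- s_sq. field. lra.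
Qed.

Lemma tail_weight_mean :
  sum_f_R0 (fun k => binom_pmf n (p_mn m n) k * tail_weight k) n <= 1 / 3.
Proof.
  set (p := p_mn m n).
  rewrite (sum_eq _ (fun k => binom_pmf n p k *
    ((7 / 20 - 9 / 10 * (N * p) / s) + 9 / 10 / s * INR k) ^ 2)).
  - rewrite binom_second_moment.
    (* Under W+ the deviation has mean 0 and variance [4p(1-p) <= 1]. *)
    replace (_ + _) with (49 / 400 + 81 / 100 * (p * (1 - p))).
    + pose proof (pow2_ge_0 (p - 1 / 2)). nra.
    + fold N. rewrite <- s_sq. field. lra.
  - intros k _. unfold tail_weight, deviation. fold p N s. f_equal. f_equal.
    field. lra.
Qed.

Lemma binom_pmf_le_shifted (k : nat) : (k <= n)%nat ->
  binom_pmf n (p_mn m n) k <=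
  51 * shifted_pmf n m k + binom_pmf n (p_mn m n) k * tail_weight k.
Proof.
  intros Hkn. assert (Hp := p_mn_bounds). set (p := p_mn m n) in *.
  assert (P0 : 0 <= binom_pmf n p k) by (apply binom_pmf_nonneg; lra).
  assert (Q0 := shifted_pmf_nonneg n m k).
  destruct (Rle_dec 1 (tail_weight k)) as [Ht|Ht]; [nra|].
  (* The endpoints are where [7/20 + 9/20 v] equals -1 and 1. *)
  assert (Hv : -3 <= deviation k <= 13 / 9) by (unfold tail_weight in Ht; nra).
  assert (Hdev := deviation_eq k).
  set (v := deviation k) in *.
  (* Bounded [v] keeps [k] a few multiples of [s] from [(N+M)/2], hence strictly between [m] and
     [n], as the peak factorization requires. *)
  assert (Hmk : (m < k)%nat) by (apply INR_lt; fold M; nra).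
  assert (Hkn' : (k < n)%nat) by (apply INR_lt; fold N; nra).
  clear Hkn.
  assert (Pk : M < INR k) by (apply lt_INR; exact Hmk).
  assert (Pn : INR k < N) by (apply lt_INR; exact Hkn').
  assert (Hpeak : binom_peak n k <= binom_peak (n - m) (k - m)).
  { replace n with (n - m + m)%nat at 1 by lia. replace k with (k - m + m)%nat at 1 by lia.
    apply binom_peak_shift. lia. }
  assert (Hpos := binom_peak_pos n k ltac:(lia)).
  assert (HP : binom_pmf n p k <= binom_peak n k * exp (- (v ^ 2 / 2))).
  { rewrite binom_pmf_peak by (lia || lra). fold N.
    apply Rmult_le_compat_l; [lra|]. apply exp_le, Ropp_le_contravar.
    replace (v ^ 2 / 2) with (N * (2 * (p - INR k / N) ^ 2)).
    - apply Rmult_le_compat_l; [lra|]. apply bernoulli_pinsker; [|exact Hp].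
      split; [apply Rdiv_lt_0_compat; lra|apply Rlt_div_l; lra].
    - unfold v, deviation. fold N s p. rewrite <- s_sq. field. lra. }
  assert (HQ : binom_peak (n - m) (k - m) * exp (- (3 / 5 * (v + d) ^ 2)) <=
               shifted_pmf n m k).
  { unfold shifted_pmf. destruct (Nat.leb_spec m k); [|lia].
    rewrite binom_pmf_peak by (lia || lra).
    apply Rmult_le_compat_l; [apply Rlt_le, binom_peak_pos; lia|].
    apply exp_le, Ropp_le_contravar.
    rewrite !minus_INR by lia. fold N M.
    set (x := (INR k - M) / (N - M)).
    assert (Hz : 2 * x - 1 = s * (v + d) / (N - M)).
    { unfold x. replace (INR k) with ((N + M + s * (v + d)) / 2) by lra. field. lra. }
    assert (Hz2 : (2 * x - 1) ^ 2 = N * (v + d) ^ 2 / (N - M) ^ 2).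
    { rewrite Hz. transitivity (s * s * (v + d) ^ 2 / (N - M) ^ 2).
      - field. lra.
      - rewrite s_sq. reflexivity. }
    (* [v + d] lies between -2 and [13/9 + 19/10 < 3.35]. *)
    assert (Hu : (v + d) ^ 2 <= 12) by nra.
    eapply Rle_trans.
    - apply Rmult_le_compat_l; [lra|]. apply bernoulli_kl_half_le.
      + unfold x. split; [apply Rdiv_lt_0_compat; lra|apply Rlt_div_l; lra].
      (* Since [N - M >= 7N/8], the quotient is at most [12 * 64/(49 N)], below [1/21] for
         [N >= 931]. *)
      + rewrite Hz2. apply Rle_div_l; nra.
    - rewrite Hz2.
      replace ((N - M) * (21 / 40 * (N * (v + d) ^ 2 / (N - M) ^ 2)))
        with (21 / 40 * (N * (v + d) ^ 2) / (N - M)) by (field; lra).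
      (* This is the source of [3/5]: [21/40 * N/(N-M) <= 21/40 * 8/7 = 3/5]. *)
      apply Rle_div_l; [lra|]. assert (0 <= (v + d) ^ 2) by apply pow2_ge_0. nra. }
  assert (HG := gaussian_profile_compare d v d_sq ltac:(lra) Hv).
  change ((7 / 20 + 9 / 20 * v) ^ 2) with (tail_weight k) in HG.
  assert (E0 := exp_pos (- (3 / 5 * (v + d) ^ 2))).
  set (g := exp (- (3 / 5 * (v + d) ^ 2))) in *.
  set (f := exp (- (v ^ 2 / 2))) in *.
  assert (binom_pmf n p k * (1 - tail_weight k) <=
          binom_peak n k * f * (1 - tail_weight k)) by (apply Rmult_le_compat_r; lra).
  assert (binom_peak n k * (f * (1 - tail_weight k)) <= binom_peak n k * (51 * g))
    by (apply Rmult_le_compat_l; lra).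
  assert (binom_peak n k * g <= binom_peak (n - m) (k - m) * g)
    by (apply Rmult_le_compat_r; lra).
  lra.
Qed.

End Pointwise.

Theorem mainTheorem1 (n m : nat) (hn : (931 <= n)%nat) (hm : (8 * m <= n)%nat)
  (S : nat -> bool) :
  prob_in n (binom_pmf n (p_mn m n)) S
    <= 51 * prob_in n (shifted_pmf n m) S + 1/3.
Proof.
  assert (Hp := p_mn_bounds n m hn hm).
  (* Trading [1/3] for the whole mean of [tail_weight] allows a termwise comparison. Outside [S]
     only a nonnegative term remains on the right. *)
  eapply Rle_trans; [|apply Rplus_le_compat_l, (tail_weight_mean n m hn hm)].
  unfold prob_in. rewrite scal_sum, <- sum_plus.
  apply sum_Rle. intros k Hk.
  assert (H := binom_pmf_le_shifted n m hn hm k Hk).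
  assert (0 <= binom_pmf n (p_mn m n) k * tail_weight n m k).
  { apply Rmult_le_pos; [apply binom_pmf_nonneg; lra|apply pow2_ge_0]. }
  destruct (S k); lra.
Qed.
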